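(* Let $\Sigma$ be a non-empty finite or countably infinite alphabet and let $\nu$ be a shift-invariant probability measure on the full shift $(\Sigma^\omega,s)$ such that there exists at least one $\alpha\in\Sigma^\omega$ generic for $\nu$. Then every finite-state selector preserves genericity for $\nu$ (i.e. for every DFA $A$ over $\Sigma$ and every $\alpha$ generic for $\nu$, if $A[\alpha]$ is infinite then $A[\alpha]$ is generic for $\nu$) if and only if $\nu$ is a Bernoulli measure for which every word in $\Sigma^*$ is admissible.
   Context: The shift is $s(a_1a_2\cdots)=a_2a_3\cdots$; cylinders $[w]=\{w\beta:\beta\in\Sigma^\omega\}$ generate the $\sigma$-algebra; $\nu$ is shift-invariant if $\nu(s^{-1}(E))=\nu(E)$ for all measurable $E$. $\nu$ is a Bernoulli measure if there is $p:\Sigma\to[0,1]$ with $\sum_ap(a)=1$ and $\nu([a_1\cdots a_n])=\prod_ip(a_i)$. A word $w$ is admissible for $\nu$ if $\nu([w])>0$. $\alpha\in\Sigma^\omega$ is generic for $\nu$ if for every admissible $w$, $\lim_N\#_w(\alpha|_{\le N})/N=\nu([w])$, where $\#_w(v)$ counts occurrences of $w$ as a contiguous block in $v$ and $\alpha|_{\le N}$ is the length-$N$ prefix. A DFA $A=(Q,\Sigma,\delta,q_s,F)$ has finitely many states and total $\delta$; $A[\alpha]$ is the subsequence of those $\alpha_i$ with $\delta^*(q_s,\alpha_1\cdots\alpha_{i-1})\in F$. *)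

(* Defs.v *)
From HB Require Import structures.
From mathcomp Require Import all_boot all_order all_algebra.
From mathcomp Require Import all_classical all_reals all_analysis.
Set Implicit Arguments. Unset Strict Implicit. Unset Printing Implicit Defensive.
Import Order.TTheory GRing.Theory Num.Theory.
Local Open Scope classical_set_scope.
Local Open Scope ring_scope.

(* Infinite words over Sigma: Sigma^omega = nat -> Sigma (position i = letter a_{i+1}). *)
Definition prefix {S : Type} (al : nat -> S) (N : nat) : seq S := mkseq al N.

Definition shift {S : Type} (al : nat -> S) : nat -> S := fun n => al n.+1.

Definition cyl {S : eqType} (w : seq S) : set (nat -> S) :=
  [set be | prefix be (size w) = w].

Definition cylinders (S : eqType) : set (set (nat -> S)) := range (@cyl S).

Arguments cylinders : clear implicits.
Definition seqspace (S : pointedType) := g_sigma_algebraType (cylinders S).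

Definition occ {S : eqType} (w v : seq S) : nat :=
  count (fun i => take (size w) (drop i v) == w) (iota 0 (size v)).

Section defs.
Context {R : realType} {S : pointedType}.
Local Notation M := (seqspace S).

Definition shift_invariant (nu : probability M R) : Prop :=
  forall E : set M, measurable E -> nu (@shift S @^-1` E) = nu E.

Definition admissible (nu : probability M R) (w : seq S) : Prop :=
  (0 < nu (cyl w))%E.

Definition generic (nu : probability M R) (al : nat -> S) : Prop :=
  forall w, admissible nu w ->
    (fun N : nat => ((occ w (prefix al N))%:R / N%:R : R)%:E) @ \oo --> nu (cyl w).

Definition bernoulli (nu : probability M R) : Prop :=
  exists p : S -> R, (forall a, 0 <= p a <= 1) /\
    (\esum_(a in [set: S]) (p a)%:E = 1)%E /\
    forall w : seq S, nu (cyl w) = (\prod_(a <- w) p a)%:E.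
End defs.

Record dfa (S : Type) := DFA {
  dfa_state : finType;
  dfa_delta : dfa_state -> S -> dfa_state;
  dfa_start : dfa_state;
  dfa_final : {set dfa_state} }.

Definition dfa_run {S} (A : dfa S) (v : seq S) : dfa_state A :=
  foldl (@dfa_delta S A) (@dfa_start S A) v.

Definition selected {S} (A : dfa S) (al : nat -> S) (i : nat) : bool :=
  dfa_run A (prefix al i) \in @dfa_final S A.

Definition sel_prefix {S} (A : dfa S) (al : nat -> S) (m : nat) : seq S :=
  [seq al i | i <- iota 0 m & selected A al i].

Definition sel_infinite {S} (A : dfa S) (al : nat -> S) : Prop :=
  forall n, exists i, (n <= i)%N /\ selected A al i.

Definition is_selection {S} (A : dfa S) (al be : nat -> S) : Prop :=
  forall n, exists m, prefix be n = sel_prefix A al m.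

(* Main.v *)
Require Import Defs.
From HB Require Import structures.
From mathcomp Require Import all_boot all_order all_algebra.
From mathcomp Require Import all_classical all_reals all_analysis.
From mathcomp Require Import ring lra zify.
Set Implicit Arguments. Unset Strict Implicit. Unset Printing Implicit Defensive.
Import Order.TTheory GRing.Theory Num.Theory.
Import numFieldNormedType.Exports.
(* [all_boot] hides [Defs.prefix] behind its boolean namesake. *)
Import Defs.
Local Open Scope classical_set_scope.
Local Open Scope ring_scope.

(* Sufficiency.  Along an ultrafilter, the joint frequencies of (state, next
   block) converge to weights mu(q, w) with sum over q equal to nu[w].  For
   fixed q, mu(q, w) / nu[w] is a bounded martingale in w, so its L2 increments
   tend to zero; stationarity under the automaton transports this decay back to
   the empty word and shows that the state is independent of the next letter.
   Independence makes the support of mu(., empty) closed along the run, so a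
   selector that fires infinitely often fires with positive density, and each
   letter has the correct frequency among the selected ones.  Blocks follow by
   induction: the frequency of wa among that of w is a letter frequency for the
   selector that waits for w in the selected sequence.  An infinite alphabet is
   reduced to a finite one since a letter only matters through its action on the
   finitely many states and its being equal to a given letter.

   Necessity.  Selecting the letter after each occurrence of w gives
   nu[wa] = nu[w] nu[a], and a letter of measure zero could be planted on a set
   of density zero where a selector would pick it out. *)

(** * Words of fixed length over a finite alphabet *)

Section Words.
Variable G : finType.

Fixpoint words (k : nat) : seq (seq G) :=
  if k is k'.+1 then [seq b :: u | b <- enum G, u <- words k'] else [:: [::]].

Lemma sum_words_cons (V : nmodType) k (F : seq G -> V) :
  \sum_(w <- words k.+1) F w = \sum_(b : G) \sum_(w <- words k) F (b :: w).
Proof. by rewrite /= big_allpairs_dep big_enum. Qed.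

Lemma sum_words_rcons (V : nmodType) k (F : seq G -> V) :
  \sum_(w <- words k.+1) F w = \sum_(w <- words k) \sum_(b : G) F (rcons w b).
Proof.
elim: k F => [|k IH] F.
  by rewrite sum_words_cons /= big_seq1; apply: eq_bigr => b _; rewrite big_seq1.
rewrite sum_words_cons [RHS]sum_words_cons; apply: eq_bigr => b _.
by rewrite IH.
Qed.

End Words.

(** * The martingale energy argument for independence of state and next letter *)

Section Energy.
Variables (R : realType) (G Q : finType) (delta : Q -> G -> Q).
Variables (p : G -> R) (mu : Q -> seq G -> R).
Local Notation P w := (\prod_(b <- w) p b).
Hypothesis p_ge0 : forall b, 0 <= p b.
Hypothesis sum_p : \sum_b p b = 1.
Hypothesis mu_ge0 : forall q w, 0 <= mu q w.
Hypothesis mu_le : forall q w, mu q w <= P w.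
Hypothesis mu_next : forall q w, \sum_b mu q (rcons w b) = mu q w.
Hypothesis mu_stat : forall q w,
  \sum_q' \sum_(b | delta q' b == q) mu q' (b :: w) = mu q w.

Let P_ge0 w : 0 <= P w.
Proof. exact: prodr_ge0. Qed.

Let mu_eq0 q w : P w = 0 -> mu q w = 0.
Proof.
by move=> P0; apply/eqP; rewrite eq_le mu_ge0 -P0 mu_le.
Qed.

Let P_rcons w b : P (rcons w b) = P w * p b.
Proof. by rewrite -cats1 big_cat /= big_seq1. Qed.

Let sum_cst (x : R) : \sum_(q : Q) x = x *+ #|Q|.
Proof. exact: sumr_const. Qed.

Lemma sum_words_prod k : \sum_(w <- words G k) P w = 1.
Proof.
elim: k => [|k IH]; first by rewrite big_seq1 big_nil.
rewrite sum_words_rcons -[RHS]IH; apply: eq_bigr => w _.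
transitivity (\sum_b P w * p b); first exact: eq_bigr.
by rewrite -mulr_sumr sum_p mulr1.
Qed.

(** Iterates [mu_stat]: the state [q] in front of [u] is reached from the state [k] letters earlier
    by reading some word [w]. *)
Lemma mu_stat_words k q u :
  \sum_(w <- words G k) \sum_(q' | foldl delta q' w == q) mu q' (w ++ u) =
  mu q u.
Proof.
elim: k q => [|k IH] q.
  by rewrite big_seq1 /= big_pred1_eq.
rewrite -[RHS]IH sum_words_cons exchange_big /=; apply: eq_bigr => w _.
under [RHS]eq_bigr do rewrite -mu_stat.
rewrite [RHS]exchange_big /= [LHS](exchange_big_dep xpredT) //=.
apply: eq_bigr => q' _.
rewrite [RHS](exchange_big_dep xpredT) //=.
rewrite big_mkcond; apply: eq_bigr => b _.
have [h|h] := boolP (foldl delta (delta q' b) w == q).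
  rewrite (bigD1 (delta q' b)) /=; last by rewrite h eqxx.
  by rewrite big1 ?addr0// => q'' /andP[/andP[_ /eqP->]]; rewrite eqxx.
by rewrite big1 // => q'' /andP[+ /eqP e]; rewrite -e (negbTE h).
Qed.

(** The second moment at time [k] of the martingale [mu q w / P w] under the product measure, summed
    over [q]. Words of probability zero contribute 0, since the inverse of 0 is 0. *)
Definition energy k := \sum_(w <- words G k) \sum_q mu q w ^+ 2 / P w.

Lemma energy_le k : energy k <= #|Q|%:R.
Proof.
apply: (@le_trans _ _ (\sum_(w <- words G k) \sum_(q : Q) P w)).
  apply: ler_sum => w _; apply: ler_sum => q _.
  have [P0|Pn0] := eqVneq (P w) 0; first by rewrite P0 invr0 mulr0.
  rewrite ler_pdivrMr ?lt0r ?Pn0 ?P_ge0//.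
  by rewrite expr2; apply: ler_pM.
rewrite (eq_bigr (fun w => P w *+ #|Q|)); last by move=> w _; rewrite sum_cst.
by rewrite sumrMnl sum_words_prod.
Qed.

(** The martingale increment along the letter [a], multiplied by [P (rcons w a)] when that is
    nonzero. *)
Definition defect a q w := mu q (rcons w a) - mu q w * p a.

(** Orthogonality of martingale increments turns the energy difference into a sum of squares over
    all letters [b], with denominators [P w * p b]. Only the letter [a] is kept, and [p a <= 1] is
    used. *)
Lemma energy_gain a k :
  \sum_(w <- words G k) \sum_q defect a q w ^+ 2 / P w <=
  energy k.+1 - energy k.
Proof.
have p_le1 : p a <= 1.
  by rewrite -sum_p (bigD1 a) //= lerDl sumr_ge0.
rewrite /energy sum_words_rcons -sumrB; apply: ler_sum => w _.
rewrite exchange_big /= -sumrB; apply: ler_sum => q _.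
have [P0|Pn0] := eqVneq (P w) 0.
  rewrite P0 invr0 !mulr0 subr0; apply: sumr_ge0 => b _.
  by rewrite mulr_ge0 ?sqr_ge0 ?invr_ge0.
have Pp : 0 < P w by rewrite lt0r Pn0 P_ge0.
have -> : (\sum_b mu q (rcons w b) ^+ 2 / P (rcons w b)) - mu q w ^+ 2 / P w =
    \sum_b defect b q w ^+ 2 / (P w * p b).
  (* Summed over [b], the cross term gives twice this quantity and the last term takes it away once,
     so the difference completes to squares. *)
  have E1 : mu q w ^+ 2 / P w =
     \sum_b (2 * mu q w / P w * mu q (rcons w b) - mu q w ^+ 2 / P w * p b).
    rewrite sumrB -!mulr_sumr mu_next sum_p.
    by field.
  rewrite [X in _ - X]E1.
  rewrite -sumrB; apply: eq_bigr => b _; rewrite P_rcons /defect.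
  have [pb0|pbn0] := eqVneq (p b) 0.
    have -> : mu q (rcons w b) = 0 by apply: mu_eq0; rewrite P_rcons pb0 mulr0.
    by rewrite pb0 !mulr0 invr0 !mulr0 !subr0.
  by field; rewrite Pn0 pbn0.
rewrite (bigD1 a) //= -[leLHS]addr0; apply: lerD; last first.
  by apply: sumr_ge0 => b _; rewrite mulr_ge0 ?sqr_ge0 ?invr_ge0 ?mulr_ge0.
have [pa0|pan0] := eqVneq (p a) 0.
  have da : defect a q w = 0.
    rewrite /defect pa0 mulr0 subr0; apply: mu_eq0.
    by rewrite P_rcons pa0 mulr0.
  by rewrite da expr0n /= !mul0r.
apply: ler_wpM2l; first exact: sqr_ge0.
have pap : 0 < p a by rewrite lt0r pan0 p_ge0.
rewrite lef_pV2 ?posrE ?mulr_gt0 //.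
by rewrite ger_pMr.
Qed.

(** By stationarity the defect at the empty word is a sum of defects at words of length [k].
    Cauchy-Schwarz with weights [P w], of total mass [#|Q|] over all pairs of a word and a state,
    gives the bound. *)
Lemma defect_sqr_le a q k :
  defect a q [::] ^+ 2 <=
  #|Q|%:R * \sum_(w <- words G k) \sum_q' defect a q' w ^+ 2 / P w.
Proof.
set E := \sum_(w <- _) _.
have card_gt0 : 0 < #|Q|%:R :> R by rewrite ltr0n; apply/card_gt0P; exists q.
set c := defect a q [::].
(* The minimiser of the quadratic [E - 2 s c + s^2 #|Q|], whose nonnegativity at this point is
   Cauchy-Schwarz. *)
pose s := c / #|Q|%:R.
have cE : c = \sum_(w <- words G k) \sum_(q' | foldl delta q' w == q)
    defect a q' w.
  rewrite /c /defect -(mu_stat_words k) -[X in _ - X * _](mu_stat_words k).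
  rewrite mulr_suml -sumrB; apply: eq_bigr => w _.
  rewrite mulr_suml -sumrB; apply: eq_bigr => q' _.
  by rewrite cats1 cats0.
have : 0 <= \sum_(w <- words G k) \sum_q'
    (defect a q' w ^+ 2 / P w
     - 2 * s * (if foldl delta q' w == q then defect a q' w else 0)
     + s ^+ 2 * P w).
  apply: sumr_ge0 => w _; apply: sumr_ge0 => q' _.
  have [P0|Pn0] := eqVneq (P w) 0.
    have -> : defect a q' w = 0.
      rewrite /defect (mu_eq0 q' P0) mul0r subr0; apply: mu_eq0.
      by rewrite P_rcons P0 mul0r.
    by rewrite P0 if_same expr0n /= !(mul0r, mulr0) subr0 addr0.
  have Pp : 0 < P w by rewrite lt0r Pn0 P_ge0.
  case: ifP => _.
    have -> : defect a q' w ^+ 2 / P w - 2 * s * defect a q' w + s ^+ 2 * P w =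
      (defect a q' w - s * P w) ^+ 2 / P w by field.
    by rewrite mulr_ge0 ?sqr_ge0 ?invr_ge0.
  by rewrite mulr0 subr0; apply: addr_ge0; apply: mulr_ge0; rewrite ?sqr_ge0 ?invr_ge0.
rewrite (eq_bigr (fun w => \sum_q' defect a q' w ^+ 2 / P w -
    2 * s * (\sum_(q' | foldl delta q' w == q) defect a q' w) +
    (s ^+ 2 * P w) *+ #|Q|)); last first.
  by move=> w _; rewrite big_split sumrB -mulr_sumr -big_mkcond /= sum_cst.
rewrite big_split sumrB /= -mulr_sumr -cE -/E sumrMnl -mulr_sumr sum_words_prod.
rewrite mulr1 -mulr_natr => h.
have : 0 <= E - c ^+ 2 / #|Q|%:R.
  apply: le_trans h _; rewrite le_eqVlt; apply/orP; left; apply/eqP.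
  by rewrite /s; field; rewrite gt_eqF.
by rewrite subr_ge0 ler_pdivrMr // mulrC.
Qed.

(* The energies increase and are bounded, so some increment is arbitrarily
   small, whereas each of them dominates the squared defect at the empty word. *)
Lemma state_letter_independent a q : mu q [:: a] = mu q [::] * p a.
Proof.
set c := defect a q [::].
have step n : c ^+ 2 *+ n <= #|Q|%:R * (energy n - energy 0).
  elim: n => [|n IH]; first by rewrite mulr0n subrr mulr0.
  have := le_trans (defect_sqr_le a q n) (ler_wpM2l (ler0n R _) (energy_gain a n)).
  rewrite -/c => h; rewrite mulrSr; apply: le_trans (lerD IH h) _.
  by rewrite -mulrDr; apply: ler_wpM2l; [exact: ler0n | lra].
have energy_ge0 : 0 <= energy 0.
  by apply: sumr_ge0 => w _; apply: sumr_ge0 => q' _; rewrite mulr_ge0 ?sqr_ge0 ?invr_ge0.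
have bnd n : c ^+ 2 *+ n <= #|Q|%:R * #|Q|%:R.
  apply: le_trans (step n) _; apply: ler_wpM2l; first exact: ler0n.
  by have := energy_le n; lra.
suff /eqP : c = 0 by rewrite subr_eq0 => /eqP.
apply/eqP; rewrite -sqrf_eq0 -[_ == _]negbK; apply/negP => cn0.
have cp : 0 < c ^+ 2 by rewrite lt0r cn0 sqr_ge0.
have := bnd (Num.bound (#|Q|%:R * #|Q|%:R / c ^+ 2)).
rewrite leNgt => /negP; apply; rewrite -[ltRHS]mulr_natl -ltr_pdivrMr //.
apply: archi_boundP; apply: divr_ge0; last exact: ltW.
by apply: mulr_ge0; exact: ler0n.
Qed.

End Energy.

(** * Counting positions *)

Definition cnt (P : pred nat) (N : nat) : nat := count P (iota 0 N).

Lemma cntS P N : cnt P N.+1 = (cnt P N + P N)%N.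
Proof. by rewrite /cnt -addn1 iotaD count_cat /= addn0. Qed.

Lemma cntS_shift (P : pred nat) N :
  (cnt (fun i => P i.+1) N + P 0)%N = (cnt P N + P N)%N.
Proof. by elim: N => // N IH; rewrite cntS addnAC IH cntS. Qed.

Lemma cnt_le P N : (cnt P N <= N)%N.
Proof. by rewrite /cnt (leq_trans (count_size _ _))// size_iota. Qed.

Lemma cnt_sub (P P' : pred nat) N : (forall i, P i -> P' i) -> (cnt P N <= cnt P' N)%N.
Proof. by move=> h; exact: sub_count. Qed.

Lemma eq_cnt (P P' : pred nat) N : P =1 P' -> cnt P N = cnt P' N.
Proof. by move=> /eq_count; exact. Qed.

Lemma cnt_partition (I : finType) (C : pred I) (F : nat -> I) P N :
  (\sum_(c | C c) cnt (fun i => P i && (F i == c)) N)%N =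
  cnt (fun i => P i && C (F i)) N.
Proof.
elim: N => [|N IH]; first by rewrite big1.
rewrite cntS -IH; under eq_bigr do rewrite cntS.
rewrite big_split /=; congr addn.
have [CF|/negbTE nCF] := boolP (C (F N)).
  rewrite (bigD1 (F N)) //= eqxx andbT big1 ?addn0// => c /andP[_ /negbTE].
  by rewrite eq_sym => ->; rewrite andbF.
rewrite andbF big1 // => c Cc; case: eqP => [e|]; last by rewrite andbF.
by move: nCF; rewrite e Cc.
Qed.

(** * Frequencies and their limits along ultrafilters *)

Section Freq.
Variable R : realType.

Definition freq (P : pred nat) (N : nat) : R := (cnt P N)%:R / N%:R.

Lemma freq_ge0 P N : 0 <= freq P N.
Proof. by rewrite divr_ge0. Qed.

Lemma freq_le1 P N : freq P N <= 1.
Proof.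
case: N => [|N]; first by rewrite /freq invr0 mulr0.
by rewrite ler_pdivrMr ?ltr0n// mul1r ler_nat cnt_le.
Qed.

Lemma freq_sub (P P' : pred nat) N : (forall i, P i -> P' i) -> freq P N <= freq P' N.
Proof.
by move=> PP'; rewrite ler_wpM2r ?invr_ge0// ler_nat cnt_sub.
Qed.

Lemma freq_partition (I : finType) (C : pred I) (F : nat -> I) P N :
  \sum_(c | C c) freq (fun i => P i && (F i == c)) N =
  freq (fun i => P i && C (F i)) N.
Proof. by rewrite -mulr_suml -natr_sum cnt_partition. Qed.

Lemma eq_freq (P P' : pred nat) N : P =1 P' -> freq P N = freq P' N.
Proof. by move=> PP'; rewrite /freq (eq_cnt _ PP'). Qed.

Lemma cvg_inv_nat : (N%:R^-1 : R) @[N --> \oo] --> 0.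
Proof.
have := @cvg_harmonic R; rewrite /harmonic => h.
rewrite -(cvg_shiftS (fun N : nat => N%:R^-1 : R)); exact: h.
Qed.

Lemma cvg_sumr (T I : Type) (F : set_system T) {FF : Filter F} (r : seq I)
    (C : pred I) (f : I -> T -> R) (l : I -> R) :
  (forall i, C i -> f i t @[t --> F] --> l i) ->
  \sum_(i <- r | C i) f i t @[t --> F] --> \sum_(i <- r | C i) l i.
Proof.
move=> fl; elim: r => [|i r IH].
  rewrite big_nil; under eq_fun do rewrite big_nil; exact: cvg_cst.
rewrite big_cons; under eq_fun do rewrite big_cons.
have [Ci|_] := boolP (C i); last exact: IH.
by apply: cvgD => //; exact: fl.
Qed.

Lemma cvgr_unique (F : set_system nat) {PF : ProperFilter F} (x : nat -> R)
    (l l' : R) : x @ F --> l -> x @ F --> l' -> l = l'.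
Proof.
move=> xl xl'; apply/eqP; rewrite eq_le; apply/andP; split.
  by apply: (ler_cvg_to xl xl'); exact: nearW.
by apply: (ler_cvg_to xl' xl); exact: nearW.
Qed.

(** Compactness of the unit interval gives a cluster point, and a cluster point of an ultrafilter is
    a limit. *)
Lemma ultra_cvg01 (F : set_system nat) (x : nat -> R) : UltraFilter F ->
  (forall N, 0 <= x N <= 1) -> exists l : R, x @ F --> l.
Proof.
move=> UF x01.
have xF : F [set N | x N \in `[0, 1]].
  by apply: filterE => N; rewrite /= in_itv /= x01.
have {xF} : (x @ F) [set` `[0, 1]] := xF.
move=> /(segment_compact (fmap_proper_filter _ _))[l [_ cl]].
exists l => V Vl; have [//|nV] := in_ultra_setVsetC (x @^-1` V) UF.
by have [y [/= ? ?]] := cl (~` V) V nV Vl.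
Qed.

(** If [x] left a neighbourhood of [l] infinitely often, the trace of [\oo] on those indices would
    extend to an ultrafilter along which [x] does not tend to [l]. *)
Lemma cvg_ultra (x : nat -> R) (l : R) :
  (forall F : set_system nat, UltraFilter F -> \oo `<=` F -> x @ F --> l) ->
  x @ \oo --> l.
Proof.
move=> xl V Vl; apply: contrapT => nV.
have pF : ProperFilter (within (~` (x @^-1` V)) \oo).
  apply: Build_ProperFilter_ex => // A wA; apply: contrapT => nA; apply: nV.
  have {}wA : \oo (fun N => ~ V (x N) -> A N) := wA.
  apply: filterS wA => N /= h; apply: contrapT => /h AN; apply: nA.
  by exists N.
have [F [UF sF]] := ultraFilterLemma pF.
have oF : \oo `<=` F by move=> A oA; apply: sF; apply: filterS oA.
have FV : F (x @^-1` V) := xl F UF oF V Vl.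
have FnV : F (~` (x @^-1` V)).
  have h : \oo (fun N => (~` (x @^-1` V)) N -> (~` (x @^-1` V)) N).
    by apply: filterE.
  exact: sF h.
by have [N []] := filter_ex (filterI FV FnV).
Qed.

End Freq.

Arguments freq {R} P N.

Definition window (T : Type) (al : nat -> T) (i n : nat) : seq T :=
  mkseq (fun j => al (i + j)%N) n.

Lemma windowS (T : Type) (al : nat -> T) i n :
  window al i n.+1 = al i :: window al i.+1 n.
Proof.
rewrite /window /mkseq /= addn0; congr cons.
by rewrite (iotaDl 1 0) -map_comp; apply: eq_map => j; rewrite /= addnA addn1.
Qed.

Lemma window_rcons (T : Type) (al : nat -> T) i n :
  window al i n.+1 = rcons (window al i n) (al (i + n)%N).
Proof. by rewrite /window /mkseq -addn1 iotaD map_cat /= -cats1. Qed.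

(** * Letter frequencies among selected positions, over a finite alphabet *)

Section FiniteAlphabet.
Variables (R : realType) (G Q : finType) (delta : Q -> G -> Q).
Variables (g : nat -> G) (st : nat -> Q) (p : G -> R) (A : {set Q}).
Hypothesis st_next : forall i, st i.+1 = delta (st i) (g i).
Hypothesis freq_g : forall u : seq G,
  freq (fun i => window g i (size u) == u) N @[N --> \oo] -->
  (\prod_(b <- u) p b : R).
Hypothesis p_gt0 : forall i, 0 < p (g i).
Hypothesis A_inf : forall n, exists i, (n <= i)%N /\ st i \in A.

Let freq_g1 b : freq (fun i => g i == b) N @[N --> \oo] --> (p b : R).
Proof.
have := @freq_g [:: b]; rewrite big_seq1 /=.
have -> // : (fun i => window g i 1 == [:: b]) = (fun i => g i == b).
by apply/funext => i; rewrite windowS eqseq_cons eqxx andbT.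
Qed.

Let p_ge0 b : 0 <= p b.
Proof.
apply: (ler_cvg_to (cvg_cst _) (@freq_g1 b)).
by apply: nearW => N; exact: freq_ge0.
Qed.

Let freqT (P : pred nat) : (forall i, P i) -> freq P N @[N --> \oo] --> (1 : R).
Proof.
move=> PT; apply: cvg_near_cst; near=> N.
rewrite /freq (@eq_cnt P xpredT) /cnt; last by move=> i; rewrite PT.
rewrite count_predT size_iota divff// pnatr_eq0 -lt0n.
by near: N; exact: nbhs_infty_gt.
Unshelve. all: by end_near. Qed.

Let sum_p : \sum_b p b = 1.
Proof.
have h := cvg_sumr (r := index_enum G) (C := xpredT) (fun b _ => @freq_g1 b).
apply: (cvgr_unique (h _)).
have -> : (fun N => \sum_b freq (fun i => g i == b) N) =
    (freq (fun i => true && xpredT (g i)) : nat -> R).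
  by apply/funext => N; rewrite -(freq_partition _ xpredT g xpredT).
exact: freqT.
Qed.

Section Ultra.
Variable F : set_system nat.
Hypothesis UF : UltraFilter F.
Hypothesis oF : \oo `<=` F.

Let cvgF (x : nat -> R) (l : R) : x @ \oo --> l -> x @ F --> l.
Proof. exact: cvg_trans (cvg_app x oF). Qed.

Let e q u N : R := freq (fun i => (st i == q) && (window g i (size u) == u)) N.
Let mu q u : R := lim (e q u @ F).

Let e_cvg q u : e q u @ F --> mu q u.
Proof.
have [N|l h] := @ultra_cvg01 R F (e q u) UF.
  by rewrite freq_ge0 freq_le1.
exact: cvgP h.
Qed.

Let mu_ge0 q u : 0 <= mu q u.
Proof.
apply: (ler_cvg_to (cvg_cst _) (@e_cvg q u)).
by apply: nearW => N; exact: freq_ge0.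
Qed.

Let mu_le q u : mu q u <= \prod_(b <- u) p b.
Proof.
apply: (ler_cvg_to (@e_cvg q u) (cvgF (@freq_g u))).
by apply: nearW => N; apply: freq_sub => i /andP[].
Qed.

Let mu_next q u : \sum_b mu q (rcons u b) = mu q u.
Proof.
have h := cvg_sumr (r := index_enum G) (C := xpredT)
  (fun b _ => @e_cvg q (rcons u b)).
apply: (cvgr_unique (h _)).
suff -> : (fun N => \sum_b e q (rcons u b) N) = e q u by exact: e_cvg.
apply/funext => N; rewrite /e.
rewrite (eq_bigr (fun b => freq (fun i => ((st i == q) &&
    (window g i (size u) == u)) && (g (i + size u)%N == b)) N)); last first.
  move=> b _; apply: eq_freq => i.
  by rewrite size_rcons window_rcons eqseq_rcons andbA.
by rewrite freq_partition; apply: eq_freq => i; rewrite andbT.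
Qed.

(** The left side observes the same event one position later, which changes the count over [N]
    positions by at most one. *)
Let mu_stat q u : \sum_q' \sum_(b | delta q' b == q) mu q' (b :: u) = mu q u.
Proof.
have h : \sum_q' \sum_(b | delta q' b == q) e q' (b :: u) N @[N --> F] -->
    \sum_q' \sum_(b | delta q' b == q) mu q' (b :: u).
  by apply: cvg_sumr => q' _; apply: cvg_sumr => b _; exact: e_cvg.
apply: (cvgr_unique h).
pose P i := (st i == q) && (window g i (size u) == u).
have -> : (fun N => \sum_q' \sum_(b | delta q' b == q) e q' (b :: u) N) =
    freq (fun i => P i.+1).
  apply/funext => N; rewrite pair_big_dep /=.
  rewrite (eq_bigr (fun c : Q * G => freq (fun i =>
     (window g i.+1 (size u) == u) && ((st i, g i) == c)) N)); last first.
    move=> [q' b] _; apply: eq_freq => i /=.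
    by rewrite windowS eqseq_cons xpair_eqE andbA andbC.
  rewrite (freq_partition R (fun c : Q * G => delta c.1 c.2 == q)).
  by apply: eq_freq => i; rewrite /P st_next andbC.
have -> : (freq (fun i => P i.+1) : nat -> R) =
    (fun N => e q u N + ((P N)%:R - (P 0)%:R) * N%:R^-1).
  apply/funext => N; rewrite /e /freq -mulrDl addrA -natrD -cntS_shift natrD.
  by rewrite addrK.
rewrite -[mu q u]addr0; apply: cvgD; first exact: e_cvg.
apply: cvgF.
have hi := @cvg_inv_nat R.
have hn : (- N%:R^-1 : R) @[N --> \oo] --> 0 by rewrite -oppr0; exact: cvgN.
apply: (squeeze_cvgr _ hn hi); apply: nearW => N.
have hN : 0 <= (N%:R^-1 : R) by rewrite invr_ge0.
by case: (P N); case: (P 0); rewrite /=; lra.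
Qed.

Let indep := state_letter_independent p_ge0 sum_p mu_ge0 mu_le mu_next mu_stat.

Let sum_mu : \sum_q mu q [::] = 1.
Proof.
have h := cvg_sumr (r := index_enum Q) (C := xpredT) (fun q _ => @e_cvg q [::]).
apply: (cvgr_unique (h _)).
suff -> : (fun N => \sum_q e q [::] N) =
    (freq (fun i => true && xpredT (st i)) : nat -> R).
  by apply: cvgF; exact: freqT.
apply/funext => N; rewrite -(freq_partition _ xpredT st xpredT).
apply: eq_bigr => q _.
by apply: eq_freq => i; rewrite andbT.
Qed.

(* Positivity propagates along the run because every letter of [g] has positive
   probability and is independent of the current state. *)
Let mu_st_gt0 i k : 0 < mu (st i) [::] -> 0 < mu (st (i + k)) [::].
Proof.
move=> mi; elim: k => [|k IH]; first by rewrite addn0.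
rewrite addnS st_next -mu_stat (bigD1 (st (i + k)%N)) //=.
rewrite (bigD1 (g (i + k)%N)) ?eqxx //= -addrA.
apply: ltr_pwDl; first by rewrite indep mulr_gt0.
by apply: addr_ge0; repeat (apply: sumr_ge0 => ? _).
Qed.

(** Some state has positive weight and is therefore visited. The run enters [A] after that visit,
    and positivity has propagated that far. *)
Let muA_gt0 : 0 < \sum_(q in A) mu q [::].
Proof.
have [q mq] : exists q, 0 < mu q [::].
  apply: contrapT => nq; have /eqP := sum_mu; rewrite big1 ?(eq_sym 0) ?oner_eq0//.
  move=> q _; apply/eqP; rewrite eq_le mu_ge0 andbT leNgt; apply/negP => mq.
  by apply: nq; exists q.
have [i sti] : exists i, st i = q.
  apply: contrapT => ni; move: mq; suff -> : mu q [::] = 0 by rewrite ltxx.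
  apply: (cvgr_unique (@e_cvg q [::])); apply: cvg_near_cst.
  apply: nearW => N; rewrite /e /freq /cnt (@eq_count _ _ pred0) ?count_pred0 ?mul0r// => j /=.
  by apply/negP => /andP[/eqP sj _]; apply: ni; exists j.
have [j [ij Aj]] := A_inf i.
rewrite (bigD1 (st j)) //=; apply: ltr_pwDl; last by apply: sumr_ge0.
by rewrite -(subnKC ij); apply: mu_st_gt0; rewrite sti.
Qed.

(** Numerator and denominator, each divided by [N], converge to sums of weights over [A].
    Independence makes the quotient of the limits [p c], and [muA_gt0] permits the division. *)
Lemma selected_ratio_ultra c :
  (cnt (fun i => (st i \in A) && (g i == c)) N)%:R /
  (cnt (fun i => st i \in A) N)%:R @[N --> F] --> (p c : R).
Proof.
have hX : freq (fun i => st i \in A) N @[N --> F] --> \sum_(q in A) mu q [::].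
  have h := cvg_sumr (r := index_enum Q) (C := mem A) (fun q _ => @e_cvg q [::]).
  apply: cvg_trans (h _); apply: near_eq_cvg; apply: nearW => N.
  rewrite (@eq_freq _ _ (fun i => true && (st i \in A)))//.
  rewrite -freq_partition; apply: eq_bigr => q _.
  by apply: eq_freq => i; rewrite andbT.
have hY : freq (fun i => (st i \in A) && (g i == c)) N @[N --> F] -->
    \sum_(q in A) mu q [:: c].
  have h := cvg_sumr (r := index_enum Q) (C := mem A) (fun q _ => @e_cvg q [:: c]).
  apply: cvg_trans (h _); apply: near_eq_cvg; apply: nearW => N.
  rewrite (@eq_freq _ _ (fun i => (g i == c) && (st i \in A))); last first.
    by move=> i; rewrite andbC.
  rewrite -freq_partition; apply: eq_bigr => q _.
  by apply: eq_freq => i /=; rewrite windowS eqseq_cons eqxx andbT andbC.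
have pE : p c = (\sum_(q in A) mu q [:: c]) / (\sum_(q in A) mu q [::]).
  under eq_bigr do rewrite indep.
  by rewrite -mulr_suml mulrAC divff ?mul1r// gt_eqF.
rewrite pE.
have nz : \sum_(q in A) mu q [::] != 0 by rewrite gt_eqF.
have h : freq (fun i => (st i \in A) && (g i == c)) N /
    freq (fun i => st i \in A) N @[N --> F] -->
    (\sum_(q in A) mu q [:: c]) / (\sum_(q in A) mu q [::]).
  by apply: cvgM hY _; exact: cvgV.
apply: cvg_trans h; apply: near_eq_cvg; apply: oF; near=> N.
rewrite /= /freq invfM invrK mulrACA mulVf ?mulr1//.
rewrite pnatr_eq0 -lt0n.
by near: N; exact: nbhs_infty_gt.
Unshelve. all: by end_near. Qed.

End Ultra.

Lemma selected_ratio_finite c :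
  (cnt (fun i => (st i \in A) && (g i == c)) N)%:R /
  (cnt (fun i => st i \in A) N)%:R @[N --> \oo] --> (p c : R).
Proof.
by apply: cvg_ultra => F UF oF; exact: selected_ratio_ultra.
Qed.

End FiniteAlphabet.

Lemma prefixS (T : Type) (al : nat -> T) n :
  prefix al n.+1 = rcons (prefix al n) (al n).
Proof. by rewrite /prefix mkseqS. Qed.

Lemma prefix_size (T : Type) (al : nat -> T) n : size (prefix al n) = n.
Proof. exact: size_mkseq. Qed.

Lemma prefix_eqP (T : Type) (be be' : nat -> T) n :
  prefix be n = prefix be' n -> forall j, (j < n)%N -> be j = be' j.
Proof.
move=> e j jn; have := congr1 (fun s => nth (be 0%N) s j) e.
by rewrite /prefix !nth_mkseq.
Qed.

Lemma take_drop_prefix (T : Type) (al : nat -> T) m i N :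
  take m (drop i (prefix al N)) = window al i (minn m (N - i)).
Proof.
rewrite /prefix /window /mkseq -map_drop -map_take drop_iota take_iota add0n.
by rewrite -[X in iota X _]addn0 iotaDl -map_comp; apply: eq_map => j.
Qed.

(** Equality can fail: a window starting before [N] may run past the end of the prefix. *)
Lemma occ_le_cnt (T : eqType) (w : seq T) (al : nat -> T) N :
  (occ w (prefix al N) <= cnt (fun i => window al i (size w) == w) N)%N.
Proof.
rewrite /occ prefix_size; apply: sub_count => i /eqP.
rewrite take_drop_prefix => e; have := congr1 size e.
by rewrite size_mkseq => ew; rewrite -[in window al i _]ew e.
Qed.

(** * Events depending on finitely many letters, over a countable alphabet *)

Section Measure.
Variables (R : realType) (S : pointedType).
Local Notation M := (seqspace S).
Hypothesis hS : countable [set: S].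

Lemma countable_code : exists f : S -> nat, injective f.
Proof.
by have /countable_injP[f fi] := hS; exists f => a b; apply: fi; rewrite inE.
Qed.

Lemma countable_code_seq : exists f : seq S -> nat, injective f.
Proof.
have [f fi] := countable_code.
exists (fun w => pickle (map f w)) => w w'.
by move=> /(pcan_inj pickleK) /(inj_map fi).
Qed.

Lemma measurable_cyl (w : seq S) : measurable (cyl w : set M).
Proof. by apply: sub_sigma_algebra; exists w. Qed.

(** Such a set is a union of cylinders, and there are only countably many words of length [n]. *)
Lemma measurable_prefix n (E : set M) :
  (forall be be' : nat -> S, prefix be n = prefix be' n -> E be -> E be') ->
  measurable E.
Proof.
move=> En; have [f fi] := countable_code_seq.
have -> : E = \bigcup_k (E `&` [set be : nat -> S | f (prefix be n) = k]).
  by apply/seteqP; split => be; [move=> Ebe; exists (f (prefix be n))|case=> k _ []].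
apply: bigcupT_measurable => k.
have [[be [Ebe fk]]|nE] := pselect (exists be : nat -> S, E be /\ f (prefix be n) = k).
  suff -> : E `&` [set be0 : nat -> S | f (prefix be0 n) = k] = cyl (prefix be n).
    exact: measurable_cyl.
  apply/seteqP; split => be' /=.
    by rewrite -fk => -[_ /fi]; rewrite /cyl /= prefix_size.
  rewrite /cyl /= prefix_size => e; split; last by rewrite e.
  exact: En (esym e) Ebe.
suff -> : E `&` [set be0 : nat -> S | f (prefix be0 n) = k] = set0 by exact: measurable0.
by apply/seteqP; split => // be' [Eb fk]; apply: nE; exists be'.
Qed.

Definition fd n (T : pred (seq S)) : set M := [set be : nat -> S | T (prefix be n)].

Lemma measurable_fd n T : measurable (fd n T).
Proof. by apply: (@measurable_prefix n) => be be' e; rewrite /fd /= e. Qed.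

Variable nu : probability M R.

Definition nuR n T : R := fine (nu (fd n T)).

Lemma nuRE n T : nu (fd n T) = (nuR n T)%:E.
Proof. by rewrite fineK // fin_num_measure //; exact: measurable_fd. Qed.

Lemma fd_cyl (w : seq S) : fd (size w) (pred1 w) = cyl w.
Proof. by apply/seteqP; split => be /= /eqP. Qed.

Lemma nu_cylE (w : seq S) : nu (cyl w) = (nuR (size w) (pred1 w))%:E.
Proof. by rewrite -nuRE fd_cyl. Qed.

Lemma nuR_ge0 n T : 0 <= nuR n T.
Proof. by rewrite fine_ge0. Qed.

Lemma nuRC n T : nuR n (predC T) = 1 - nuR n T.
Proof.
apply: EFin_inj; rewrite EFinB -!nuRE -probability_setC; last exact: measurable_fd.
by congr (nu _); apply/seteqP; split => be /=; rewrite /fd /= => /negP.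
Qed.

Lemma nuR_disjoint n (T T' : pred (seq S)) : (forall w, T w -> ~~ T' w) ->
  nuR n (predU T T') = nuR n T + nuR n T'.
Proof.
move=> TT'; apply: EFin_inj; rewrite EFinD -!nuRE -measureU //=; try exact: measurable_fd.
- by congr (nu _); apply/seteqP; split => be /=; rewrite /fd /= => /orP.
- by apply/seteqP; split => be //= -[/TT' /negP].
Qed.

Lemma nuR_ext n (T T' : pred (seq S)) : (forall w, size w = n -> T w = T' w) -> nuR n T = nuR n T'.
Proof.
move=> TT'; rewrite /nuR; congr (fine (nu _)).
by apply/seteqP; split => be; rewrite /fd /= TT' // prefix_size.
Qed.

Lemma nuR_cvg n (T : pred (seq S)) (f : seq S -> nat) :
  nuR n (fun w => T w && (f w < k)%N) @[k --> \oo] --> nuR n T.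
Proof.
pose F k := fd n (fun w => T w && (f w < k)%N).
have UF : \bigcup_k F k = fd n T.
  apply/seteqP; split => be; first by case=> k _ /andP[].
  by move=> Tb; exists (f (prefix be n)).+1 => //; apply/andP; split.
have h : (nu \o F) k @[k --> \oo] --> (nuR n T)%:E.
  rewrite -nuRE -UF; apply: nondecreasing_cvg_mu.
  - by move=> k; exact: measurable_fd.
  - by rewrite UF; exact: measurable_fd.
  - move=> k k' kk'; apply/subsetPset => be /andP[Tb fb].
    by apply/andP; split => //; exact: leq_trans fb kk'.
exact: fine_cvg h.
Qed.

Lemma nu_split (h : M -> nat) (E : set M) : measurable E ->
  (forall k, measurable [set be | h be = k]) ->
  nu E = (\sum_(k <oo) nu (E `&` [set be | h be = k]))%E.
Proof.
move=> mE mh.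
rewrite -measure_semi_bigcup.
- congr (nu _); apply/seteqP; split => be; last by case=> k _ [].
  by move=> Eb; exists (h be).
- by move=> k; exact: measurableI.
- apply/trivIsetP => i j _ _ /eqP ij; apply/seteqP; split => // be.
  by move=> [[_ /= hi] [_ /= hj]]; case: ij; rewrite -hi -hj.
- by apply: bigcupT_measurable => k; exact: measurableI.
Qed.

(** Countable additivity over the level sets of [h] and [h'] reduces a proportionality of measures
    to single codes of words or letters. *)
Lemma nu_split_mul (h h' : M -> nat) (E E' : set M) (c : R) :
  measurable E -> measurable E' ->
  (forall k, measurable [set be | h be = k]) ->
  (forall k, measurable [set be | h' be = k]) ->
  (forall k, nu (E `&` [set be | h be = k]) =
     (c%:E * nu (E' `&` [set be | h' be = k]))%E) ->
  nu E = (c%:E * nu E')%E.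
Proof.
move=> mE mE' mh mh' e; rewrite (nu_split mE mh) (nu_split mE' mh').
by rewrite -nneseriesZl //; apply: eq_eseriesr => k _; exact: e.
Qed.

Lemma generic_cvg al : generic nu al -> forall w, admissible nu w ->
  (occ w (prefix al N))%:R / N%:R @[N --> \oo] --> nuR (size w) (pred1 w).
Proof.
move=> gal w /gal; rewrite nu_cylE => /fine_cvg; exact.
Qed.

Lemma cvg_generic al : (forall w, admissible nu w ->
    (occ w (prefix al N))%:R / N%:R @[N --> \oo] --> nuR (size w) (pred1 w)) ->
  generic nu al.
Proof.
move=> h w /h hw; rewrite nu_cylE; apply: cvg_EFin; last exact: hw.
exact: nearW.
Qed.

(** Genericity controls one word at a time, hence finite sets of words. These exhaust [T] in measure
    and can only underestimate its frequency, so they yield a lower bound. *)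
Lemma freq_set_lower al n (T : pred (seq S)) (e : R) : generic nu al -> 0 < e ->
  \forall N \near \oo, nuR n T - e <= freq (fun i => T (window al i n)) N.
Proof.
move=> gal; have [f fi] := countable_code_seq.
pose Tk k := [pred w | T w && (f w < k)%N].
have low k d : 0 < d ->
    \forall N \near \oo, nuR n (Tk k) - d <= freq (fun i => Tk k (window al i n)) N.
  elim: k d => [|k IH] d d0.
    apply: nearW => N.
    have -> : nuR n (Tk 0) = 0.
      apply: EFin_inj; rewrite -nuRE (_ : fd _ _ = set0) ?measure0//.
      by apply/seteqP; split => // be /=; rewrite /fd /= ltn0 andbF.
    by have := freq_ge0 R (fun i => Tk 0 (window al i n)) N; lra.
  (* Raising the code bound from [k] to [k.+1] adds at most one word, as [f] is injective. *)
  have [[w [sw [Tw fw]]]|nw] := pselect (exists w, size w = n /\ T w /\ f w = k); last first.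
    have -> : nuR n (Tk k.+1) = nuR n (Tk k).
      apply: nuR_ext => w sw; rewrite /Tk /= ltnS leq_eqVlt.
      case Tw: (T w) => //=; case: eqP => //= fw; case: nw; by exists w.
    apply: filterS (IH d d0) => N; move/le_trans; apply; apply: freq_sub => i.
    by case/andP=> Ti fk; rewrite /Tk /= Ti ltnW.
  have d2 : 0 < d / 2 by rewrite divr_gt0.
  have -> : nuR n (Tk k.+1) = nuR n (Tk k) + nuR n (pred1 w).
    rewrite -nuR_disjoint; last first.
      move=> v /andP[_ fv]; apply/eqP => vw; by move: fv; rewrite vw fw ltnn.
    apply: nuR_ext => v _; rewrite /Tk /= ltnS leq_eqVlt andb_orr orbC; congr orb.
    apply/andP/eqP => [[_ /eqP]|->]; last by rewrite fw.
    by rewrite -fw => /fi.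
  have wlow : \forall N \near \oo, nuR n (pred1 w) - d / 2 <=
      freq (fun i => window al i n == w) N.
    have occle N : (occ w (prefix al N))%:R / N%:R <= freq (fun i => window al i n == w) N :> R.
      by rewrite ler_wpM2r ?invr_ge0// ler_nat -sw occ_le_cnt.
    have [aw|naw] := pselect (admissible nu w); last first.
      have w0 : nuR n (pred1 w) = 0.
        apply/eqP; rewrite eq_le nuR_ge0 andbT leNgt; apply/negP => pw; apply: naw.
        by rewrite /admissible nu_cylE sw lte_fin.
      by apply: nearW => N; rewrite w0; have := freq_ge0 R (fun i => window al i n == w) N; lra.
    have /cvgrPdist_le/(_ _ d2) := generic_cvg gal aw; apply: filterS => N.
    by rewrite sw => /ler_normlP[h1 h2]; have := occle N; lra.
  apply: filterS2 (IH _ d2) wlow => N h1 h2.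
  have -> : freq (fun i => Tk k.+1 (window al i n)) N =
     freq (fun i => Tk k (window al i n)) N + freq (fun i => window al i n == w) N :> R.
    rewrite /freq -mulrDl -natrD; congr (_%:R / _).
    rewrite /cnt -count_predUI [X in (_ + X)%N](_ : _ = 0)%N ?addn0; last first.
      rewrite (@eq_count _ _ pred0) ?count_pred0// => i /=.
      by apply/negP => /andP[/andP[_ +] /eqP ww]; rewrite ww fw ltnn.
    apply: eq_count => i; rewrite /= ltnS leq_eqVlt andb_orr orbC; congr orb.
    apply/andP/eqP => [[_ /eqP]|->]; last by rewrite fw.
    by rewrite -fw => /fi.
  by lra.
move=> e0; have e2 : 0 < e / 2 by rewrite divr_gt0.
have /cvgrPdist_le/(_ _ e2)[k _ /(_ k (leqnn _)) hk] := @nuR_cvg n T f.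
apply: filterS (low k _ e2) => N h.
have : freq (fun i => Tk k (window al i n)) N <= freq (fun i => T (window al i n)) N :> R.
  by apply: freq_sub => i /andP[].
by move/ler_normlP: hk => [h1 h2]; rewrite /Tk in h *; lra.
Qed.

(** The frequencies of [T] and of its complement add up to 1, so the lower bound for the complement
    is an upper bound for [T]. *)
Lemma freq_set_cvg al n (T : pred (seq S)) : generic nu al ->
  freq (fun i => T (window al i n)) N @[N --> \oo] --> nuR n T.
Proof.
move=> gal; apply/cvgrPdist_le => e e0; near=> N.
have N0 : (0 < N)%N by near: N; exact: nbhs_infty_gt.
have h1 : nuR n T - e <= freq (fun i => T (window al i n)) N.
  by near: N; exact: freq_set_lower.
have h2 : nuR n (predC T) - e <= freq (fun i => predC T (window al i n)) N.
  by near: N; exact: freq_set_lower.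
move: h2; rewrite nuRC.
have -> : freq (fun i => predC T (window al i n)) N =
    1 - freq (fun i => T (window al i n)) N :> R.
  rewrite /freq -[X in X - _](@divff _ N%:R) ?pnatr_eq0 -?lt0n//.
  rewrite -mulrBl; congr (_ / _); apply/eqP; rewrite eq_sym subr_eq -natrD eqr_nat.
  by rewrite addnC /cnt count_predC size_iota.
by move=> h2; apply/ler_normlP; split; lra.
Unshelve. all: by end_near. Qed.

(** * Independence under a Bernoulli measure *)

Section Product.
Hypothesis nu_bern : bernoulli nu.

Lemma bernoulli_rcons w a : nu (cyl (rcons w a)) = (nu (cyl [:: a]) * nu (cyl w))%E.
Proof.
have [p [_ [_ hp]]] := nu_bern.
by rewrite !hp -cats1 big_cat /= !big_seq1 -EFinM mulrC.
Qed.

Lemma measurable_letter (f : S -> nat) n k : measurable [set be : M | f (be n) = k].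
Proof.
apply: (@measurable_prefix n.+1) => be be' e /= <-.
by rewrite (prefix_eqP e).
Qed.

Lemma nu_prefix_letter n (T : pred (seq S)) a :
  nu [set be : nat -> S | T (prefix be n) && (be n == a)] =
  (nu (cyl [:: a]) * nu (fd n T))%E.
Proof.
have [f fi] := countable_code_seq; rewrite (nu_cylE [:: a]).
have mf k : measurable [set be : M | f (prefix be n) = k].
  by apply: (@measurable_prefix n) => be be' /= ->.
apply: (@nu_split_mul (fun be => f (prefix be n)) (fun be => f (prefix be n))) => //.
- apply: (@measurable_prefix n.+1) => be be' e /=.
  by rewrite (prefix_eqP e (ltnSn n)); have := e; rewrite !prefixS => /rcons_inj[->].
- exact: measurable_fd.
move=> k; rewrite -nu_cylE.
have [[w [sw [Tw fw]]]|nw] := pselect (exists w, size w = n /\ T w /\ f w = k).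
  rewrite [X in nu X = _](_ : _ = cyl (rcons w a)); last first.
    apply/seteqP; split => be; rewrite /cyl /= size_rcons sw prefixS.
      by case=> /andP[_ /eqP ->]; rewrite -fw => /fi ->.
    by move=> /rcons_inj[-> ->]; rewrite Tw eqxx.
  rewrite bernoulli_rcons; congr (_ * nu _)%E.
  apply/seteqP; split => be; rewrite /cyl /fd /= sw; first by move=> ->.
  by case=> _; rewrite -fw => /fi.
rewrite [X in nu X = _](_ : _ = set0); last first.
  apply/seteqP; split => // be /= [/andP[Tb _] fb]; apply: nw.
  by exists (prefix be n); rewrite prefix_size.
rewrite [X in (_ * nu X)%E](_ : _ = set0) ?measure0 ?mule0//.
apply/seteqP; split => // be [Tb fb]; apply: nw.
by exists (prefix be n); rewrite prefix_size.
Qed.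

(** Sums [nu_prefix_letter] over the letters satisfying [U], possibly infinitely many. *)
Lemma nu_prefix_next n (T : pred (seq S)) (U : pred S) :
  nu [set be : nat -> S | T (prefix be n) && U (be n)] =
  (nu (fd n T) * nu [set be : nat -> S | U (be 0%N)])%E.
Proof.
have [f fi] := countable_code; rewrite nuRE.
apply: (@nu_split_mul (fun be => f (be n)) (fun be => f (be 0%N))); try exact: measurable_letter.
- apply: (@measurable_prefix n.+1) => be be' e /=.
  by rewrite (prefix_eqP e (ltnSn n)); have := e; rewrite !prefixS => /rcons_inj[->].
- by apply: (@measurable_prefix 1) => be be' e /=; rewrite (prefix_eqP e (ltnSn 0)).
move=> k; rewrite -nuRE.
have [[a [Ua fa]]|na] := pselect (exists a, U a /\ f a = k).
  rewrite [X in nu X = _](_ : _ = [set be : nat -> S | T (prefix be n) && (be n == a)]).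
    rewrite nu_prefix_letter muleC; congr (_ * nu _)%E.
    apply/seteqP; split => be; rewrite /cyl /=.
      by rewrite prefixS => -[->].
    by case=> _; rewrite -fa => /fi; rewrite prefixS => ->.
  apply/seteqP; split => be /=.
    by case=> /andP[-> _]; rewrite -fa => /fi ->; rewrite eqxx.
  by case/andP=> -> /eqP ->.
rewrite [X in nu X = _](_ : _ = set0); last first.
  apply/seteqP; split => // be /= [/andP[_ Ub] fb]; apply: na.
  by exists (be n).
rewrite [X in (_ * nu X)%E](_ : _ = set0) ?measure0 ?mule0//.
by apply/seteqP; split => // be [Ub fb]; apply: na; exists (be 0%N).
Qed.

(** Independence survives a letterwise map, which is what permits passing to a finite alphabet of
    letter classes. *)
Lemma nuR_map_prod (G : eqType) (pi : S -> G) (W : seq G) :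
  nuR (size W) (fun w => map pi w == W) =
  \prod_(c <- W) nuR 1 (fun w => map pi w == [:: c]).
Proof.
elim/last_ind: W => [|W c IH].
  rewrite big_nil; apply: EFin_inj; rewrite -nuRE -(@probability_setT _ _ _ nu).
  by congr (nu _); apply/seteqP; split => be.
rewrite -cats1 big_cat /= big_seq1 -IH cats1 size_rcons.
apply: EFin_inj; rewrite EFinM -!nuRE.
rewrite [X in (_ * nu X)%E](_ : _ = [set be : nat -> S | pi (be 0%N) == c]).
  rewrite -(nu_prefix_next (size W) (fun w => map pi w == W) (fun a => pi a == c)).
  congr (nu _); apply/seteqP.
  by split => be; rewrite /fd /mkset prefixS map_rcons eqseq_rcons.
by apply/seteqP; split => be; rewrite /fd /mkset /= eqseq_cons andbT.
Qed.

End Product.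

End Measure.

(** * Occurrences located by where they end *)

Lemma suffix_prefixE (T : eqType) (w : seq T) (al : nat -> T) N :
  suffix w (prefix al N) =
  (size w <= N)%N && (window al (N - size w) (size w) == w).
Proof.
rewrite suffixE prefix_size -[drop _ _](@take_oversize _ N); last first.
  by rewrite size_drop prefix_size leq_subr.
rewrite take_drop_prefix; case: leqP => wN.
  by congr (window al _ _ == _); lia.
apply/negP => /eqP /(congr1 size); rewrite size_mkseq; lia.
Qed.

Lemma occ_prefixE (T : eqType) (w : seq T) a (al : nat -> T) N :
  occ (rcons w a) (prefix al N) =
  cnt (fun i => window al i (size w).+1 == rcons w a) (N - size w).
Proof.
rewrite /occ prefix_size size_rcons.
have h i : (take (size w).+1 (drop i (prefix al N)) == rcons w a) =
    (i < N - size w)%N && (window al i (size w).+1 == rcons w a).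
  rewrite take_drop_prefix; case: ltnP => iN.
    by congr (window al _ _ == _); lia.
  by apply/negP => /eqP /(congr1 size); rewrite size_mkseq size_rcons; lia.
rewrite (eq_count h) /cnt.
have -> : iota 0 N = iota 0 (N - size w) ++ iota (N - size w) (N - (N - size w)).
  by rewrite -[X in _ ++ iota X _]add0n -iotaD; congr iota; lia.
rewrite count_cat [X in (_ + X)%N](_ : _ = 0)%N ?addn0.
  by apply: eq_in_count => i; rewrite mem_iota add0n => /andP[_ ->].
rewrite -(count_pred0 (iota (N - size w) (N - (N - size w)))).
apply: eq_in_count => i; rewrite mem_iota => /andP[iN _].
by rewrite ltnNge iN.
Qed.

(** Indexing an occurrence by its last letter makes it an event of a selector: [w] has just been
    read and the next letter is [a]. *)
Lemma occ_rcons (T : eqType) (w : seq T) a (al : nat -> T) N :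
  occ (rcons w a) (prefix al N) =
  cnt (fun j => suffix w (prefix al j) && (al j == a)) N.
Proof.
elim: N => [|N IH]; first by rewrite occ_prefixE.
rewrite cntS -IH !occ_prefixE suffix_prefixE; case: leqP => wN.
  rewrite subSn // cntS window_rcons eqseq_rcons.
  by rewrite subnK //.
have -> : (N.+1 - size w = 0)%N by lia.
by have -> : (N - size w = 0)%N by lia.
Qed.

(** The correction term is the occurrence ending exactly at [N]. The empty word takes none, since
    [occ] counts it at [N] starting points and not at [N + 1]. *)
Lemma occ_suffix (T : eqType) (w : seq T) (al : nat -> T) N :
  occ w (prefix al N) = (cnt (fun j => suffix w (prefix al j)) N +
    ((w != [::]) && suffix w (prefix al N)))%N.
Proof.
case/lastP: w => [|w a].
  rewrite addn0 /occ prefix_size; apply: eq_count => i.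
  by rewrite take0 suffix0s.
have -> : rcons w a != [::] by case: w.
rewrite -cntS_shift occ_rcons.
have -> : suffix (rcons w a) (prefix al 0) = false by rewrite suffixs0; case: (w).
rewrite addn0.
by apply: eq_cnt => j; rewrite prefixS suffix_rcons andbC eq_sym.
Qed.

(** * Automata that wait for a word, and selected sequences *)

Section Dfa.
Variable S : eqType.
Implicit Types (A D : dfa S) (al be : nat -> S).

Lemma dfa_run_rcons A v x : dfa_run A (rcons v x) = dfa_delta (dfa_run A v) x.
Proof. by rewrite /dfa_run foldl_rcons. Qed.

Lemma sel_prefixS A al m : sel_prefix A al m.+1 =
  if selected A al m then rcons (sel_prefix A al m) (al m) else sel_prefix A al m.
Proof.
rewrite /sel_prefix -addn1 iotaD filter_cat map_cat /= add0n.
by case: ifP => _; rewrite ?cats0 ?cats1.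
Qed.

(** To detect [rcons w a], the automaton for [w] is given one extra bit: whether it was accepting
    just before reading an [a]. *)
Lemma suffix_dfa (w : seq S) :
  exists D, forall v, (dfa_run D v \in dfa_final D) = suffix w v.
Proof.
elim/last_ind: w => [|w a [D hD]].
  exists (@DFA S unit (fun _ _ => tt) tt [set: unit]%SET) => v.
  by rewrite inE suffix0s.
pose D' := @DFA S (dfa_state D * bool)%type
  (fun q x => (dfa_delta q.1 x, (a == x) && (q.1 \in dfa_final D)))
  (dfa_start D, false) [set q | q.2]%SET.
have run v : dfa_run D' v = (dfa_run D v, suffix (rcons w a) v).
  elim/last_ind: v => [|v x IH]; first by rewrite suffixs0; case: (w).
  by rewrite !dfa_run_rcons IH /= hD suffix_rcons.
by exists D' => v; rewrite run inE.
Qed.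

(** The detector of [w] advances only on letters that [A] selects, so it reads the selected
    sequence. *)
Lemma select_after_dfa A (w : seq S) : exists B, forall al i,
  selected B al i = selected A al i && suffix w (sel_prefix A al i).
Proof.
have [D hD] := suffix_dfa w.
pose B := @DFA S (dfa_state A * dfa_state D)%type
  (fun q x => (dfa_delta q.1 x,
     if q.1 \in dfa_final A then dfa_delta q.2 x else q.2))
  (dfa_start A, dfa_start D)
  [set q | (q.1 \in dfa_final A) && (q.2 \in dfa_final D)]%SET.
exists B => al i.
have run : dfa_run B (prefix al i) =
    (dfa_run A (prefix al i), dfa_run D (sel_prefix A al i)).
  elim: i => [//|i IH]; rewrite prefixS sel_prefixS !dfa_run_rcons IH /=.
  by rewrite -/(selected A al i); case: ifP => // _; rewrite dfa_run_rcons.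
by rewrite /selected run inE /= hD.
Qed.

(** Selected positions of [al] correspond in order to positions of [be], and [sel_prefix] is the
    part of [be] already read. *)
Lemma cnt_selected (P : seq S -> S -> bool) A al be M N :
  prefix be M = sel_prefix A al N ->
  cnt (fun i => selected A al i && P (sel_prefix A al i) (al i)) N =
  cnt (fun j => P (prefix be j) (be j)) M.
Proof.
elim: N M => [|N IH] M.
  by move=> /(congr1 size); rewrite prefix_size /= => ->.
rewrite sel_prefixS cntS; case: ifP => [sN|_]; last by rewrite addn0 => /IH.
case: M => [/(congr1 size)|M]; first by rewrite size_rcons.
by rewrite prefixS cntS => /rcons_inj[e1 e2]; rewrite (IH M e1) -e1 -e2.
Qed.

Lemma size_sel_prefix A al N : size (sel_prefix A al N) = cnt (selected A al) N.
Proof. by rewrite /sel_prefix size_map size_filter. Qed.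

Lemma sel_prefix_cat A al N k :
  exists t, sel_prefix A al (N + k) = sel_prefix A al N ++ t.
Proof.
elim: k => [|k [t e]]; first by exists [::]; rewrite addn0 cats0.
rewrite addnS sel_prefixS e; case: ifP => _; last by exists t.
by exists (rcons t (al (N + k)%N)); rewrite rcons_cat.
Qed.

Lemma size_sel_prefix_surj A al : sel_infinite A al ->
  forall n, exists m, size (sel_prefix A al m) = n.
Proof.
move=> infA; elim=> [|n [m sm]]; first by exists 0%N.
have [i [mi Ai]] := infA m.
apply: contrapT => nm.
have h k : size (sel_prefix A al (m + k)) = n.
  elim: k => [|k IH]; first by rewrite addn0.
  rewrite addnS sel_prefixS; case: ifP => // Ak.
  by case: nm; exists (m + k).+1; rewrite sel_prefixS Ak size_rcons IH.
by apply: nm; exists i.+1; rewrite sel_prefixS Ai size_rcons -(subnKC mi) h.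
Qed.

Lemma selection_exists A al : sel_infinite A al -> exists be, is_selection A al be /\
  forall N, sel_prefix A al N = prefix be (size (sel_prefix A al N)).
Proof.
move=> infA; have [m sm] := choice (size_sel_prefix_surj infA).
(* The default is never reached: the selected prefix at [m n.+1] has [n.+1] letters. *)
pose be n := nth (al 0%N) (sel_prefix A al (m n.+1)) n.
suff h N : sel_prefix A al N = prefix be (size (sel_prefix A al N)).
  by exists be; split => // n; exists (m n); rewrite h sm.
apply: (@eq_from_nth _ (al 0%N)); first by rewrite prefix_size.
move=> j jN; rewrite /prefix nth_mkseq // /be.
have jm : (j < size (sel_prefix A al (m j.+1)))%N by rewrite sm.
have [le|/ltnW le] := leqP N (m j.+1).
  have [t e] := sel_prefix_cat A al N (m j.+1 - N); rewrite subnKC // in e.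
  by rewrite e nth_cat jN.
have [t e] := sel_prefix_cat A al (m j.+1) (N - m j.+1); rewrite subnKC // in e.
by rewrite e nth_cat jm.
Qed.

End Dfa.

(** * Densities of occurrences *)

Section Density.
Variable R : realType.

Lemma cvg_bool_div (b : nat -> bool) : (b N)%:R / N%:R @[N --> \oo] --> (0 : R).
Proof.
apply: (squeeze_cvgr _ (cvg_cst _) (@cvg_inv_nat R)); apply: nearW => N.
have hN : 0 <= (N%:R^-1 : R) by rewrite invr_ge0.
by case: (b N); rewrite /= ?mul1r ?mul0r ?lexx hN.
Qed.

(** By [occ_suffix] the two counts differ by at most one, which vanishes after division by [N]. *)
Lemma occ_cvgP (T : eqType) (w : seq T) (al : nat -> T) (l : R) :
  (occ w (prefix al N))%:R / N%:R @[N --> \oo] --> l <->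
  freq (fun j => suffix w (prefix al j)) N @[N --> \oo] --> l.
Proof.
pose b N := (w != [::]) && suffix w (prefix al N).
have e : (fun N => (occ w (prefix al N))%:R / N%:R) =
    (fun N => freq (fun j => suffix w (prefix al j)) N + (b N)%:R / N%:R : R).
  by apply/funext => N; rewrite occ_suffix natrD mulrDl.
split=> h.
- rewrite -[l]subr0.
  have -> : (freq (fun j => suffix w (prefix al j)) : nat -> R) =
     (fun N => (occ w (prefix al N))%:R / N%:R - (b N)%:R / N%:R).
    by apply/funext => N; have /(congr1 (@^~ N)) /= -> := e; rewrite addrK.
  by apply: cvgB => //; exact: cvg_bool_div.
- by rewrite e -[l]addr0; apply: cvgD => //; exact: cvg_bool_div.
Qed.

Lemma cnt_mono P N N' : (N <= N')%N -> (cnt P N <= cnt P N')%N.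
Proof.
by move=> NN'; rewrite -(subnKC NN') /cnt iotaD count_cat leq_addr.
Qed.

(** A bounded count divided by [N] would tend to 0. *)
Lemma freq_unbounded (P : pred nat) (l : R) : 0 < l ->
  freq P N @[N --> \oo] --> l -> forall n, exists N, (n < cnt P N)%N.
Proof.
move=> l0 Pl n; apply: contrapT => nN.
suff : l <= 0 by rewrite leNgt l0.
have h0 : (n%:R / N%:R : R) @[N --> \oo] --> 0.
  by rewrite -[0](mulr0 n%:R); apply: cvgM;
    [exact: cvg_cst | exact: cvg_inv_nat].
apply: (ler_cvg_to Pl h0); apply: nearW => N.
rewrite ler_wpM2r ?invr_ge0// ler_nat leqNgt; apply/negP => nP.
by apply: nN; exists N.
Qed.

Lemma cnt_gt_exists (P : pred nat) n N : (n < cnt P N)%N -> exists i, (n <= i)%N /\ P i.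
Proof.
elim: N => [//|N IH]; rewrite cntS; case PN: (P N); last by rewrite addn0.
have [nN _|Nn] := leqP n N; first by exists N.
by rewrite addn1 ltnS => h; have := leq_trans h (cnt_le P N); rewrite leqNgt Nn.
Qed.

End Density.

(** * Sufficiency: selection from a generic sequence under a Bernoulli measure *)

Section Agafonov.
Variables (R : realType) (S : pointedType).
Hypothesis hS : countable [set: S].
Variable nu : probability (seqspace S) R.

Lemma nuR_gt0 w : admissible nu w -> 0 < nuR nu (size w) (pred1 w).
Proof. by rewrite /admissible (nu_cylE hS) lte_fin. Qed.

Lemma nuR_eq0 w : ~ admissible nu w -> nuR nu (size w) (pred1 w) = 0.
Proof.
move=> nw; apply/eqP; rewrite eq_le nuR_ge0 andbT leNgt; apply/negP => pw.
by apply: nw; rewrite /admissible (nu_cylE hS) lte_fin.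
Qed.

Lemma nuR_le n m (T T' : pred (seq S)) :
  (forall be, T (prefix be n) -> T' (prefix be m)) -> nuR nu n T <= nuR nu m T'.
Proof.
move=> TT'; rewrite -lee_fin -!(nuRE hS); apply: le_measure.
- by rewrite inE; exact: measurable_fd.
- by rewrite inE; exact: measurable_fd.
- by move=> be; exact: TT'.
Qed.

Lemma nuR_nil : nuR nu 0 (pred1 [::]) = 1.
Proof.
apply: EFin_inj; rewrite -(nuRE hS) -(@probability_setT _ _ _ nu).
by congr (nu _); apply/seteqP; split => be.
Qed.

Section Bernoulli.
Hypothesis nu_bern : bernoulli nu.
Hypothesis nu_adm : forall w, admissible nu w.

Lemma letter_ratio al (B : dfa S) a : generic nu al -> sel_infinite B al ->
  (cnt (fun i => selected B al i && (al i == a)) N)%:R /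
  (cnt (selected B al) N)%:R @[N --> \oo] --> nuR nu 1 (pred1 [:: a]).
Proof.
move=> gal infB.
(* Only the class of a letter matters, so the alphabet becomes finite: whether
   the letter is [a], and how it acts on the states. *)
pose G := (bool * {ffun dfa_state B -> dfa_state B})%type.
pose pi x : G := (x == a, [ffun q => dfa_delta q x]).
pose g i := pi (al i).
pose st i := dfa_run B (prefix al i).
pose p (c : G) := nuR nu 1 (fun w => map pi w == [:: c]).
have st_next i : st i.+1 = (g i).2 (st i).
  by rewrite /st prefixS dfa_run_rcons /g /= ffunE.
have windowE i n : window g i n = map pi (window al i n).
  by rewrite /window /mkseq -map_comp.
have freq_g u : freq (fun i => window g i (size u) == u) N @[N --> \oo] -->
    \prod_(b <- u) p b.
  rewrite -(nuR_map_prod hS nu_bern).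
  have := freq_set_cvg hS (n := size u) (T := fun w => map pi w == u) gal.
  by under eq_fun do under eq_fun do rewrite -windowE.
(* The class of [al i] contains the letter [al i], which is admissible by [nu_adm]. *)
have p_gt0 i : 0 < p (g i).
  apply: lt_le_trans (nuR_gt0 (nu_adm [:: al i])) _.
  by apply: nuR_le => be /= /eqP[->].
have main c := @selected_ratio_finite R G _ (fun q c => c.2 q) g st p
  (dfa_final B) st_next freq_g p_gt0 infB c.
(* The classes with first component true together are the letter [a]; both sides are limits of the
   same frequency along [al]. *)
have pE : nuR nu 1 (pred1 [:: a]) = \sum_(c : G | c.1) p c.
  have h1 := freq_set_cvg hS (n := 1) (T := pred1 [:: a]) gal.
  apply: (cvgr_unique h1).
  have h : \sum_(c : G | c.1) freq (fun i => g i == c) N @[N --> \oo] -->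
      \sum_(c : G | c.1) p c.
    apply: cvg_sumr => c _; have := freq_g [:: c]; rewrite big_seq1 /=.
    by under eq_fun do under eq_fun do rewrite windowS eqseq_cons andbT.
  apply: cvg_trans h; apply: near_eq_cvg; apply: nearW => N.
  rewrite (freq_partition R (fun c : G => c.1) g xpredT); apply: eq_freq => i.
  by rewrite /= windowS eqseq_cons andbT.
rewrite pE.
have h : \sum_(c : G | c.1) ((cnt (fun i => (st i \in dfa_final B) && (g i == c)) N)%:R /
     (cnt (fun i => st i \in dfa_final B) N)%:R) @[N --> \oo] --> \sum_(c : G | c.1) p c.
  by apply: cvg_sumr => c _; exact: main.
apply: cvg_trans h; apply: near_eq_cvg; apply: nearW => N.
by rewrite -mulr_suml -natr_sum (cnt_partition (fun c : G => c.1) g).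
Qed.

Lemma selection_generic (A : dfa S) al be : generic nu al -> sel_infinite A al ->
  is_selection A al be -> generic nu be.
Proof.
move=> gal infA selA; apply: (cvg_generic hS) => w _.
elim/last_ind: w => [|w a IH].
  rewrite nuR_nil; apply: cvg_near_cst; near=> N.
  rewrite /occ prefix_size (@eq_count _ _ predT) ?count_predT ?size_iota; last first.
    by move=> i; rewrite /= take0.
  rewrite divff// pnatr_eq0 -lt0n.
  by near: N; exact: nbhs_infty_gt.
have /occ_cvgP cw := IH.
have w0 := nuR_gt0 (nu_adm w).
have [B hB] := select_after_dfa A w.
have XE M N : prefix be M = sel_prefix A al N ->
    cnt (selected B al) N = cnt (fun j => suffix w (prefix be j)) M.
  move=> /(cnt_selected (fun v _ => suffix w v)) <-.
  by apply: eq_cnt => i; rewrite hB.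
have YE M N : prefix be M = sel_prefix A al N ->
    cnt (fun i => selected B al i && (al i == a)) N = occ (rcons w a) (prefix be M).
  rewrite occ_rcons => /(cnt_selected (fun v x => suffix w v && (x == a))) <-.
  by apply: eq_cnt => i; rewrite hB andbA.
(* By the induction hypothesis [w] has positive frequency in [be], so [B] fires infinitely often. *)
have infB : sel_infinite B al.
  move=> n; have [M nM] := freq_unbounded w0 cw n.
  have [N eN] := selA M; apply: (@cnt_gt_exists _ _ N).
  by rewrite (XE _ _ eN).
have ratio : (occ (rcons w a) (prefix be M))%:R /
    (cnt (fun j => suffix w (prefix be j)) M)%:R @[M --> \oo] --> nuR nu 1 (pred1 [:: a]).
  (* The limit is transferred from positions [N] of [al] to positions [M] of [be]: the first [M]
     selected letters need at least [M] positions, so [N] is large when [M] is. *)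
  have /cvgrPdist_le h := letter_ratio (a := a) gal infB.
  apply/cvgrPdist_le => e /h [N0 _ hN0]; exists N0 => // M /= N0M.
  have [N eN] := selA M.
  have MN : (M <= N)%N.
    by rewrite -(prefix_size be M) eN size_sel_prefix cnt_le.
  by have := hN0 N (leq_trans N0M MN); rewrite /= (XE _ _ eN) (YE _ _ eN).
have -> : nuR nu (size (rcons w a)) (pred1 (rcons w a)) =
    nuR nu 1 (pred1 [:: a]) * nuR nu (size w) (pred1 w).
  by apply: EFin_inj; rewrite EFinM -!(nu_cylE hS) (bernoulli_rcons nu_bern).
have h : (occ (rcons w a) (prefix be M))%:R /
    (cnt (fun j => suffix w (prefix be j)) M)%:R *
    freq (fun j => suffix w (prefix be j)) M @[M --> \oo] -->
    nuR nu 1 (pred1 [:: a]) * nuR nu (size w) (pred1 w).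
  exact: cvgM.
apply: cvg_trans h; apply: near_eq_cvg; apply: nearW => M.
have [c0|cn0] := eqVneq (cnt (fun j => suffix w (prefix be j)) M) 0%N.
  suff -> : occ (rcons w a) (prefix be M) = 0%N by rewrite !mul0r.
  apply/eqP; rewrite -leqn0 -c0 occ_rcons; apply: cnt_sub => i.
  by case/andP.
by rewrite /freq mulrA divfK // pnatr_eq0.
Unshelve. all: by end_near. Qed.

End Bernoulli.

End Agafonov.

(** * A sparse set of positions: pairs indexed by squares *)

Section Squares.

Definition square (k : nat) : bool := has (fun m => m * m == k)%N (iota 0 k.+1).

Lemma squareP k : reflect (exists m, m * m = k)%N (square k).
Proof.
apply: (iffP hasP) => [[m _ /eqP mk]|[m mk]]; first by exists m.
by exists m; [rewrite mem_iota; nia | rewrite mk].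
Qed.

(** If there are [c] squares below [N], they are those of 0 up to [c - 1]. *)
Lemma cnt_square N : (N <= cnt square N * cnt square N)%N /\
  ((0 < cnt square N)%N -> ((cnt square N).-1 * (cnt square N).-1 < N)%N).
Proof.
elim: N => [//|N]; rewrite cntS; set c := cnt square N => -[lo hi].
case: squareP => [[m mN]|nsq] /=; last first.
  have : N <> (c * c)%N by move=> e; apply: nsq; exists c.
  by rewrite addn0; split; [lia | move=> /hi; lia].
have -> : c = m.
  apply/eqP; rewrite eqn_leq; apply/andP; split; last by nia.
  rewrite leqNgt; apply/negP => mc.
  have c0 : (0 < c)%N by lia.
  have := hi c0; have : (m <= c.-1)%N by lia.
  by nia.
by rewrite addn1 /=; split; [nia | move=> _; nia].
Qed.

(** With [c] the count, [N] is at least [(c - 1)^2 + 1], and the bound becomes [(c - 2)^2 >= 0]. *)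
Lemma cnt_square_sqr N : (cnt square N * cnt square N <= 2 * N)%N.
Proof.
have [lo hi] := cnt_square N; case: N lo hi => // N.
by case: (cnt square N.+1) => // c /=; nia.
Qed.

(** Marks the two consecutive positions [2 m^2] and [2 m^2 + 1] for each [m]. *)
Definition square_pair i := square i./2.

Lemma cnt_square_pair N : (cnt square_pair N <= 2 * cnt square N)%N.
Proof.
have h K : cnt square_pair K.*2 = (2 * cnt square K)%N.
  elim: K => // K IH; rewrite doubleS !cntS IH /square_pair /= uphalf_double doubleK.
  by lia.
have [K NK KN] : exists2 K, (N <= K.*2)%N & (K <= N)%N by exists N => //; lia.
by rewrite (leq_trans (cnt_mono _ NK)) // h leq_mul2l cnt_mono ?orbT.
Qed.

Lemma freq_square_pair (R : realType) :
  freq square_pair N @[N --> \oo] --> (0 : R).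
Proof.
apply/cvgrPdist_le => e e0.
(* The squared count of marked positions is at most [8 N], so the squared frequency is at most
   [8 / N]. *)
have e8 : 0 < e ^+ 2 / 8 by rewrite divr_gt0 ?exprn_gt0.
near=> N.
rewrite sub0r normrN ger0_norm ?freq_ge0//.
have N0 : 0 < N%:R :> R by rewrite ltr0n; near: N; exact: nbhs_infty_gt.
have hN : (N%:R^-1 : R) <= e ^+ 2 / 8.
  near: N; have /cvgrPdist_le/(_ _ e8) := @cvg_inv_nat R.
  by apply: filterS => N; rewrite sub0r normrN ger0_norm ?invr_ge0.
rewrite -(@ler_pXn2r _ 2) ?nnegrE ?freq_ge0 ?(ltW e0)//.
have h : (cnt square_pair N * cnt square_pair N <= 8 * N)%N.
  by have := cnt_square_sqr N; have := cnt_square_pair N; nia.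
rewrite /freq expr_div_n ler_pdivrMr ?exprn_gt0//.
apply: (@le_trans _ _ (8 * N%:R)).
  by rewrite expr2 -natrM -natrM ler_nat.
have -> : 8 * N%:R = 8 * N%:R^-1 * N%:R ^+ 2 :> R by field; rewrite gt_eqF.
by rewrite ler_wpM2r ?sqr_ge0//; lra.
Unshelve. all: by end_near. Qed.

End Squares.

(** * Necessity: preservation of genericity forces a Bernoulli measure of full support *)

Section Necessity.
Variables (R : realType) (S : pointedType).
Hypothesis hS : countable [set: S].
Variable nu : probability (seqspace S) R.
Hypothesis pres : forall (A : dfa S) (al : nat -> S), generic nu al ->
  sel_infinite A al -> forall be : nat -> S, is_selection A al be -> generic nu be.

(** On inadmissible words genericity is silent, but there the window frequency tends to 0 by
    [freq_set_cvg] and dominates the occurrences. *)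
Lemma generic_occ_cvg al w : generic nu al ->
  (occ w (prefix al N))%:R / N%:R @[N --> \oo] --> nuR nu (size w) (pred1 w).
Proof.
move=> gal; have [aw|naw] := pselect (admissible nu w).
  exact: (generic_cvg hS gal).
have := freq_set_cvg hS (n := size w) (T := pred1 w) gal.
rewrite (nuR_eq0 hS naw) => h.
apply: (squeeze_cvgr _ (cvg_cst _) h); apply: nearW => N.
by rewrite divr_ge0//= ler_wpM2r ?invr_ge0// ler_nat occ_le_cnt.
Qed.

(** Each position where the sequences differ spoils at most [size w] occurrences. In the induction,
    a lost [rcons w a] comes from a changed last letter or from a [w] lost one step earlier. *)
Lemma cnt_suffix_diff (al al' : nat -> S) w N :
  (cnt (fun j => suffix w (prefix al j)) N <=
   cnt (fun j => suffix w (prefix al' j)) N +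
   size w * cnt (fun j => al' j != al j) N)%N.
Proof.
pose d := fun j => suffix w (prefix al j) && ~~ suffix w (prefix al' j).
have hd : (cnt (fun j => suffix w (prefix al j)) N <=
    cnt (fun j => suffix w (prefix al' j)) N + cnt d N)%N.
  elim: (N) => // n; rewrite !cntS /d.
  by case: (suffix w (prefix al n)); case: (suffix w (prefix al' n)) => /=; lia.
apply: leq_trans hd _; rewrite leq_add2l {}/d.
elim/last_ind: w => [|w a IH].
  by rewrite (@eq_cnt _ pred0) /cnt ?count_pred0// => j; rewrite !suffix0s.
case: N IH => // N IH.
have h : (cnt (fun j => suffix (rcons w a) (prefix al j) &&
     ~~ suffix (rcons w a) (prefix al' j)) N.+1 <=
   cnt (fun j => suffix w (prefix al j) && ~~ suffix w (prefix al' j)) N +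
   cnt (fun j => al' j != al j) N)%N.
  elim: (N) => [|n IHn].
    by rewrite cntS /= suffixs0; case: (w).
  rewrite [in leqLHS]cntS ![in leqRHS]cntS !prefixS !suffix_rcons.
  have := IHn; case: (eqVneq (al' n) (al n)) => [->|_].
    by case: (a == al n); case: (suffix w (prefix al n));
       case: (suffix w (prefix al' n)) => /=; lia.
  by case: (_ && _) => /=; lia.
apply: leq_trans h _; rewrite size_rcons mulSn addnC leq_add //.
  by rewrite cnt_mono.
apply: leq_trans IH; by rewrite cnt_mono.
Qed.

Lemma generic_density0 al al' : generic nu al ->
  freq (fun j => al' j != al j) N @[N --> \oo] --> (0 : R) -> generic nu al'.
Proof.
move=> gal d0; apply: (cvg_generic hS) => w _.
have /occ_cvgP hal := generic_occ_cvg (w := w) gal.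
apply/occ_cvgP.
have wd0 : (size w)%:R * freq (fun j => al' j != al j) N @[N --> \oo] --> (0 : R).
  by rewrite -[0](mulr0 (size w)%:R); apply: cvgM => //; exact: cvg_cst.
have h1 : freq (fun j => suffix w (prefix al j)) N -
   (size w)%:R * freq (fun j => al' j != al j) N @[N --> \oo] --> nuR nu (size w) (pred1 w).
  by rewrite -[nuR _ _ _]subr0; apply: cvgB.
have h2 : freq (fun j => suffix w (prefix al j)) N +
   (size w)%:R * freq (fun j => al' j != al j) N @[N --> \oo] --> nuR nu (size w) (pred1 w).
  by rewrite -[nuR _ _ _]addr0; apply: cvgD.
apply: (squeeze_cvgr _ h1 h2); apply: nearW => N.
apply/andP; split.
  rewrite lerBlDr /freq mulrA -mulrDl ler_wpM2r ?invr_ge0// -natrM -natrD ler_nat.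
  exact: cnt_suffix_diff.
rewrite /freq mulrA -mulrDl ler_wpM2r ?invr_ge0// -natrM -natrD ler_nat.
rewrite (@eq_cnt (fun j => al' j != al j) (fun j => al j != al' j)).
  exact: cnt_suffix_diff.
by move=> j; rewrite eq_sym.
Qed.

(** Otherwise the whole space would be a countable union of null cylinders. *)
Lemma admissible_letter_exists : exists a : S, admissible nu [:: a].
Proof.
have [f fi] := countable_code hS.
apply: contrapT => na.
have := @nu_split _ _ nu (fun be => f (be 0%N)) setT measurableT.
move=> /(_ (fun k => measurable_letter hS f 0 k)).
rewrite probability_setT eseries0; first by move/eqP; rewrite onee_eq0.
move=> k _ _; rewrite setTI.
have [[a fa]|nfa] := pselect (exists a, f a = k); last first.
  rewrite (_ : [set _ | _] = set0) ?measure0//.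
  by apply/seteqP; split => // be /= e; apply: nfa; exists (be 0%N).
rewrite (_ : [set _ | _] = cyl [:: a]).
  by rewrite (nu_cylE hS) (nuR_eq0 hS) // => aa; apply: na; exists a.
apply/seteqP; split => be; rewrite /cyl /mkset /=.
  by rewrite -fa => /fi <-.
by case=> ->.
Qed.

(* If [b] has measure zero, occurrences of [bb] may be planted on a set of
   density zero, and selecting the letter after [b] then yields [bbb...]. *)
Lemma letters_admissible al b : generic nu al -> admissible nu [:: b].
Proof.
move=> gal; apply: contrapT => nb.
have [a aa] := admissible_letter_exists.
have ab : a != b by apply/eqP => e; apply: nb; rewrite -e.
(* Every other [b] is overwritten by the admissible letter [a], so that [b] occurs exactly at the
   planted positions. *)
pose al' i := if square_pair i then b else if al i == b then a else al i.
have al'b i : (al' i == b) = square_pair i.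
  rewrite /al'; case: ifP => _; first exact: eqxx.
  by case: ifP => [_|->//]; rewrite (negbTE ab).
have gal' : generic nu al'.
  apply: (generic_density0 gal).
  have h1 := freq_set_cvg hS (n := 1) (T := pred1 [:: b]) gal.
  rewrite (nuR_eq0 hS nb) in h1.
  have h2 : freq square_pair N + freq (fun i => pred1 [:: b] (window al i 1)) N
      @[N --> \oo] --> (0 : R).
    rewrite -[0 in X in _ --> X]addr0; apply: cvgD => //; exact: freq_square_pair.
  apply: (squeeze_cvgr _ (cvg_cst _) h2); apply: nearW => N.
  rewrite freq_ge0 /= /freq -mulrDl ler_wpM2r ?invr_ge0// -natrD ler_nat.
  rewrite /cnt -count_predUI; apply: leq_trans (leq_addr _ _).
  apply: sub_count => i; rewrite /= windowS eqseq_cons andbT /al'.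
  by case: ifP => //= _; case: ifP => //; rewrite eqxx.
(* The state resets after each selection, so [A] is back at [false] at every even position even when
   planted pairs are adjacent, and selects exactly the second letter of each pair. *)
pose A := @DFA S bool (fun s x => ~~ s && (x == b)) false [set true]%SET.
have runA k : dfa_run A (prefix al' k.*2) = false /\
    dfa_run A (prefix al' k.*2.+1) = square k.
  have step i : dfa_run A (prefix al' i.+1) = ~~ dfa_run A (prefix al' i) && square_pair i.
    by rewrite prefixS dfa_run_rcons /= al'b.
  elim: k => [|k [_ IH]]; first by rewrite step.
  have e : dfa_run A (prefix al' k.+1.*2) = false.
    by rewrite doubleS step IH /square_pair /= uphalf_double andNb.
  by split => //; rewrite step e /= /square_pair doubleK.
have selA i : selected A al' i = odd i && square i./2.
  rewrite /selected inE -[in LHS](odd_double_half i); case: (odd i) => /=.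
    by rewrite add1n (runA _).2 eqb_id.
  by rewrite add0n (runA _).1.
have infA : sel_infinite A al'.
  move=> n; exists (n * n).*2.+1; split; first by nia.
  rewrite selA /= odd_double /= uphalf_double; apply/squareP; by exists n.
have [be [sbe _]] := selection_exists infA.
have beb j : be j = b.
  have [m em] := sbe j.+1.
  have : be j \in prefix be j.+1 by rewrite prefixS mem_rcons mem_head.
  rewrite em => /mapP[i]; rewrite mem_filter selA => /andP[/andP[_ si] _] ->.
  by apply/eqP; rewrite al'b.
have gbe := pres gal' infA sbe.
have := generic_occ_cvg (w := [:: a]) gbe.
rewrite (_ : (fun N => _) = (fun=> 0)); last first.
  apply/funext => N; rewrite (occ_rcons [::]) (@eq_cnt _ pred0).
    by rewrite /cnt count_pred0 mul0r.
  by move=> j; rewrite /= beb eq_sym (negbTE ab) andbF.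
move=> /(cvgr_unique (cvg_cst _)) /= e.
by have := nuR_gt0 hS aa; rewrite -e ltxx.
Qed.

(** The letters following occurrences of [w] form a selected, hence generic, sequence. The ratio of
    the counts of [rcons w a] and [w] therefore tends to the measure of [[:: a]]. *)
Lemma nuR_rcons al w a : generic nu al -> admissible nu w ->
  nuR nu (size w).+1 (pred1 (rcons w a)) =
  nuR nu (size w) (pred1 w) * nuR nu 1 (pred1 [:: a]).
Proof.
move=> gal aw; have w0 := nuR_gt0 hS aw.
(* This automaton selects everything, so [select_after_dfa] specialises to selecting after [w] in
   [al] itself. *)
pose A := @DFA S unit (fun _ _ => tt) tt [set: unit]%SET.
have selA be i : selected A be i by rewrite /selected inE.
have spA be N : sel_prefix A be N = prefix be N.
  by elim: N => // N IH; rewrite sel_prefixS selA prefixS IH.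
have [B hB] := select_after_dfa A w.
have {}hB i : selected B al i = suffix w (prefix al i) by rewrite hB selA spA.
have /occ_cvgP hw := generic_occ_cvg (w := w) gal.
have infX n := freq_unbounded w0 hw n.
have XE N : cnt (selected B al) N = cnt (fun j => suffix w (prefix al j)) N.
  exact: eq_cnt.
have infB : sel_infinite B al.
  by move=> n; have [N nN] := infX n; apply: (@cnt_gt_exists _ _ N); rewrite XE.
have [be [sbe pbe]] := selection_exists infB.
have gbe := pres gal infB sbe.
pose X N := cnt (fun j => suffix w (prefix al j)) N.
have YE N : occ [:: a] (prefix be (X N)) = occ (rcons w a) (prefix al N).
  rewrite (occ_rcons [::]) occ_rcons.
  have e : prefix be (X N) = sel_prefix B al N by rewrite pbe size_sel_prefix XE.
  have := cnt_selected (fun _ x => x == a) e.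
  rewrite (@eq_cnt (fun i => _ && _) (fun j => suffix w (prefix al j) && (al j == a))).
    by move=> ->; apply: eq_cnt => j; rewrite suffix0s.
  by move=> i; rewrite hB.
have ratio : (occ (rcons w a) (prefix al N))%:R / (X N)%:R @[N --> \oo] -->
    nuR nu 1 (pred1 [:: a]).
  have /cvgrPdist_le h := generic_occ_cvg (w := [:: a]) gbe.
  apply/cvgrPdist_le => e /h [M0 _ hM0].
  have [N0 M0N0] := infX M0; exists N0 => // N /= N0N.
  have := hM0 (X N) (leq_trans (ltnW M0N0) (cnt_mono _ N0N)).
  by rewrite /= YE.
have h1 : (occ (rcons w a) (prefix al N))%:R / (X N)%:R *
    freq (fun j => suffix w (prefix al j)) N @[N --> \oo] -->
    nuR nu 1 (pred1 [:: a]) * nuR nu (size w) (pred1 w).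
  exact: cvgM.
have h2 := generic_occ_cvg (w := rcons w a) gal.
rewrite size_rcons in h2; rewrite mulrC; apply: (cvgr_unique h2).
apply: cvg_trans h1; apply: near_eq_cvg; apply: nearW => N.
have [c0|cn0] := eqVneq (X N) 0%N.
  suff -> : occ (rcons w a) (prefix al N) = 0%N by rewrite !mul0r.
  apply/eqP; rewrite -leqn0 -c0 occ_rcons; apply: cnt_sub => i.
  by case/andP.
by rewrite /freq mulrA divfK // pnatr_eq0.
Qed.

(** The space is partitioned by the code of the first letter. Codes that belong to no letter give
    empty pieces, so the series reindexes to a sum over letters. *)
Lemma esum_letters : (\esum_(a in [set: S]) (nuR nu 1 (pred1 [:: a]))%:E = 1)%E.
Proof.
have [f fi] := countable_code hS.
have := @nu_split _ _ nu (fun be => f (be 0%N)) setT measurableT.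
move=> /(_ (fun k => measurable_letter hS f 0 k)).
rewrite probability_setT nneseries_esumT // => ->.
pose F k := nu (setT `&` [set be : seqspace S | f (be 0%N) = k]).
have FE a : (nuR nu 1 (pred1 [:: a]))%:E = F (f a).
  rewrite -(nu_cylE hS nu [:: a]) /F setTI; congr (nu _).
  apply/seteqP; split => be; rewrite /cyl /mkset /=; first by case=> ->.
  by move=> /fi <-.
have bij : set_bij [set: S] (range f) f.
  by split; [move=> a _; exists a | move=> a b _ _; exact: fi | move=> _ [a _ <-]; exists a].
rewrite (eq_esum (fun a _ => FE a)) -(reindex_esum _ _ _ F bij).
rewrite esum_mkcond; apply: eq_esum => k _; case: ifPn => // nk.
rewrite -[LHS](@measure0 _ _ _ nu) /F; congr (nu _).
apply/seteqP; split => // be [_ /= fk]; move: nk; rewrite notin_setE; apply.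
by exists (be 0%N).
Qed.

Lemma preserving_bernoulli al : generic nu al ->
  bernoulli nu /\ forall w, admissible nu w.
Proof.
move=> gal.
pose p a := nuR nu 1 (pred1 [:: a]).
have p_gt0 a : 0 < p a := nuR_gt0 hS (letters_admissible a gal).
(* Both facts go together: extending the product formula by a letter uses admissibility of [w],
   which follows from the formula for [w]. *)
have prodE w : nu (cyl w) = (\prod_(a <- w) p a)%:E /\ admissible nu w.
  have adm v : nu (cyl v) = (\prod_(a <- v) p a)%:E -> admissible nu v.
    by rewrite /admissible => ->; rewrite lte_fin; apply: prodr_gt0.
  suff h : nu (cyl w) = (\prod_(a <- w) p a)%:E by split => //; exact: adm.
  elim/last_ind: w => [|w a IH].
    by rewrite big_nil (nu_cylE hS) nuR_nil.
  rewrite (nu_cylE hS) size_rcons (nuR_rcons a gal (adm _ IH)).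
  by rewrite -cats1 big_cat /= big_seq1 EFinM -(nu_cylE hS) IH -EFinM.
split; last by move=> w; have [] := prodE w.
exists p; split; last split; last by move=> w; have [] := prodE w.
- move=> a; rewrite ltW //= -lee_fin -(nu_cylE hS nu [:: a]).
  by apply: probability_le1; exact: measurable_cyl.
- exact: esum_letters.
Qed.

End Necessity.

Theorem theorem6p3 (R : realType) (S : pointedType)
  (hS : countable [set: S]) (nu : probability (seqspace S) R)
  (hinv : shift_invariant nu)
  (hgen : exists al : nat -> S, generic nu al) :
  (forall (A : dfa S) (al : nat -> S), generic nu al ->
     sel_infinite A al ->
     forall be : nat -> S, is_selection A al be -> generic nu be)
  <-> (bernoulli nu /\ forall w : seq S, admissible nu w).
Proof.
split=> [pres|[bern adm] A al gal infA be sel].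
  by have [al gal] := hgen; exact: preserving_bernoulli gal.
exact: selection_generic sel.
Qed.
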